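(* Let $d, N, M \ge 1$ be integers, $r \in \{0,1,\dots,d\}$, $\sigma \ge 0$, and let $\Lambda \in \mathbb{R}^{d\times d}$ be symmetric positive semidefinite with eigendecomposition $\Lambda = QDQ^\top$, $Q$ orthonormal, $D = \mathrm{diag}([\lambda_1,\dots,\lambda_d])$, $\lambda_1\ge\dots\ge\lambda_d\ge 0$. Let $V^* = \mathrm{diag}([v_1^*,\dots,v_d^*])$ with $v_i^* = \frac{N}{(N+1)\lambda_i + \mathrm{tr}(D)}$ for $i \le r$ and $v_i^* = 0$ for $i>r$, let $c \neq 0$, $U^* = cQV^*Q^\top$, $u = 1/c$, and let $f$ be the linear self-attention model $$f(E) = \left[E + W^{PV} E \cdot \frac{E^\top W^{KQ} E}{M}\right]_{(d+1),(M+1)}, \qquad W^{PV} = \begin{pmatrix} 0_{d\times d} & 0_d \\ 0_d^\top & u\end{pmatrix},\quad W^{KQ} = \begin{pmatrix} U^* & 0_d \\ 0_d^\top & 0\end{pmatrix},$$ applied to an input $E \in \mathbb{R}^{(d+1)\times(M+1)}$ (the output is the bottom-right entry). Fix $w \in \mathbb{R}^d$ and write $w = Q(s+\xi)$ where $s,\xi\in\mathbb{R}^d$ satisfy $s_i = 0$ for all $r < i \le d$ and $\xi_i = 0$ for all $1 \le i \le r$. Let $x_1,\dots,x_M,x_q \overset{\text{i.i.d.}}{\sim}\mathcal{N}(0,\Lambda)$ and independently $\epsilon_1,\dots,\epsilon_M \overset{\text{i.i.d.}}{\sim}\mathcal{N}(0,\sigma^2)$, and let $$\widehat{E} = \begin{pmatrix}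 x_1 & \cdots & x_M & x_q \\ \langle w,x_1\rangle + \epsilon_1 & \cdots & \langle w,x_M\rangle + \epsilon_M & 0\end{pmatrix}.$$ Then $$\mathbb{E}_{x_1,\epsilon_1,\dots,x_M,\epsilon_M,x_q}\left(f(\widehat E) - \langle w, x_q\rangle\right)^2 = \frac1M\|s\|^2_{(V^* )^2D^3} + \frac1M\left(\|s+\xi\|_D^2 + \sigma^2\right)\mathrm{tr}\left((V^* )^2D^2\right) + \|\xi\|_D^2 + \sum_{i\in[r]} s_i^2\lambda_i(\lambda_i v_i^* - 1)^2.$$
   Context: For a positive semidefinite matrix $A$, $\|x\|_A^2 := x^\top A x$. $[r] = \{1,\dots,r\}$. The model $f$ is the optimal rank-$r$ one-layer linear self-attention solution for in-context linear regression with $N$ pretraining examples per prompt; at evaluation the normalization factor equals the number $M$ of in-context examples. *)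

(* Defs.v *)
From HB Require Import structures.
From mathcomp Require Import all_boot all_order all_algebra.
From mathcomp Require Import all_classical all_reals all_analysis.
Set Implicit Arguments. Unset Strict Implicit. Unset Printing Implicit Defensive.
Import Order.TTheory GRing.Theory Num.Theory.
Local Open Scope classical_set_scope.
Local Open Scope ring_scope.

Section LSA.
Context {R : realType}.

Definition qform n (A : 'M[R]_n) (x : 'cV[R]_n) : R := (x^T *m A *m x) 0 0.

Definition gauss_law (v : R) : set R -> \bar R :=
  if v == 0 then @dirac _ R (0 : R) R else normal_prob 0 (Num.sqrt v).

Context {dT : measure_display} {T : measurableType dT}.

Definition has_law (P : probability T R) (Y : T -> R) (mu : set R -> \bar R) :=
  measurable_fun setT Y /\
  forall B : set R, measurable B -> P (Y @^-1` B) = mu B.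

Definition gaussian_vector (P : probability T R) n (X : 'I_n -> T -> R)
    (L : 'M[R]_n) :=
  (forall k, measurable_fun setT (X k)) /\
  forall a : 'cV[R]_n,
    has_law P (fun t => \sum_(k < n) a k 0 * X k t) (gauss_law (qform L a)).

(** mutual independence of the random elements ("blocks") i : I, where
    block i consists of the real coordinates C k with blk k = i *)
Definition indep_blocks (P : probability T R) (K I : finType) (blk : K -> I)
    (C : K -> T -> R) :=
  (forall k, measurable_fun setT (C k)) /\
  forall B : K -> set R, (forall k, measurable (B k)) ->
    P (\bigcap_(k in [set: K]) (C k @^-1` B k)) =
    (\prod_(i : I) P (\bigcap_(k in [set k | blk k = i]) (C k @^-1` B k)))%E.

End LSA.

(** Components of the random data: x_j (j < M) coordinates, x_q coordinates,
    and eps_j (j < M). Blocks: x_j, x_q, eps_j. *)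
Definition comp_index (d M : nat) : finType := (('I_M * 'I_d) + 'I_d + 'I_M)%type.
Definition block_index (M : nat) : finType := ('I_M + unit + 'I_M)%type.

Definition comp_block (d M : nat) (k : comp_index d M) : block_index M :=
  match k with
  | inl (inl (j, _)) => inl (inl j)
  | inl (inr _) => inl (inr tt)
  | inr j => inr j
  end.

Definition comp_rv {R : realType} {T : Type} (d M : nat)
    (xs : 'I_M -> 'I_d -> T -> R) (xq : 'I_d -> T -> R) (eps : 'I_M -> T -> R)
    (k : comp_index d M) : T -> R :=
  match k with
  | inl (inl (j, i)) => xs j i
  | inl (inr i) => xq i
  | inr j => eps j
  end.

Section Model.
Context {R : realType}.

(** v*_i (0-indexed: i < r means paper's i <= r) *)
Definition vstar (d N r : nat) (lam : 'I_d -> R) (i : 'I_d) : R :=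
  if (i < r)%N then N%:R / (N.+1%:R * lam i + \sum_(k < d) lam k) else 0.

Definition diagv d (a : 'I_d -> R) : 'M[R]_d := diag_mx (\row_i a i).

Definition W_PV (d : nat) (u : R) : 'M[R]_d.+1 :=
  castmx (addn1 d, addn1 d) (block_mx 0 0 0 (u%:M : 'M[R]_1)).
Definition W_KQ (d : nat) (U : 'M[R]_d) : 'M[R]_d.+1 :=
  castmx (addn1 d, addn1 d) (block_mx U 0 0 (0 : 'M[R]_1)).

Definition lsa (d M : nat) (WPV WKQ : 'M[R]_d.+1) (E : 'M[R]_(d.+1, M.+1)) : R :=
  (E + WPV *m E *m ((M%:R)^-1 *: (E^T *m WKQ *m E))) ord_max ord_max.

Definition Ehat (d M : nat) (X : 'M[R]_(d, M)) (xq : 'cV[R]_d) (y : 'rV[R]_M)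
  : 'M[R]_(d.+1, M.+1) :=
  castmx (addn1 d, addn1 M) (block_mx X xq y (0 : 'M[R]_1)).

End Model.

(* Main.v *)
Require Import Defs.
From HB Require Import structures.
From mathcomp Require Import all_boot all_order all_algebra.
From mathcomp Require Import all_classical all_reals all_analysis.
From mathcomp Require Import measurable_realfun ring lra.
Import Order.TTheory GRing.Theory Num.Theory.
Import numFieldNormedType.Exports.
Local Open Scope classical_set_scope.
Local Open Scope ring_scope.

(* In the rotated coordinates z = Q^T x the prediction error is
   \sum_k zq_k G_k with G_k = v_k / M \sum_j z_jk y_j - b_k and b = s + xi.
   The query zq is independent of G and has diagonal covariance, so the squared
   error is \sum_k lam_k E[G_k^2]; the summands of G_k are i.i.d. over j, so
   E[G_k^2] = v_k^2 / M Var(z_1k y_1) + (v_k lam_k b_k - b_k)^2, and the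
   variance follows from Isserlis' formula for E[z_k^2 <b, z>^2].
   The Gaussian moments come from integrating the derivative of
   x^k exp(- x^2 / 2 s^2) over [-n, n] and letting n tend to infinity;
   products of functions of disjoint families of blocks are handled by the
   pi-lambda theorem followed by Fubini on the joint law. *)

(** * Moments of the Gaussian density with respect to Lebesgue measure *)

Section gaussian_moments.
Context {R : realType}.
Implicit Types (m s t x : R) (n k : nat).
Local Notation mu := (@lebesgue_measure R).

(** The density and the Radon-Nikodym derivative have the same integral over every measurable set,
    hence agree almost everywhere. The nonnegative form asks for no integrability, so it can serve
    to prove integrability. *)
Lemma ge0_integral_normal_prob m s (f : R -> \bar R) :
  measurable_fun [set: R] f -> (forall x, 0 <= f x)%E ->
  (\int[normal_prob m s]_x f x =
   \int[mu]_x (f x * (normal_pdf m s x)%:E))%E.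
Proof.
move=> mf f0.
have dom := normal_prob_dominates m s.
rewrite -(Radon_Nikodym_SigmaFinite.change_of_variables dom)//=.
apply: ae_eq_integral => //.
- apply: emeasurable_funM => //.
  exact: measurable_int (Radon_Nikodym_SigmaFinite.f_integrable dom).
- apply: emeasurable_funM => //; apply/measurable_EFinP.
  exact: measurable_normal_pdf.
- apply: ae_eqe_mul2l; apply: integral_ae_eq => //.
  + exact: Radon_Nikodym_SigmaFinite.f_integrable.
  + by apply/measurable_EFinP; exact: measurable_normal_pdf.
  + by move=> E _ mE; rewrite -Radon_Nikodym_SigmaFinite.f_integral.
Qed.

(** For y >= 0 the exponential series gives y^n / n! <= [expR y], and one of the two exponentials on
    the right is that of [|x|]. *)
Lemma exprn_le_expR x n : `|x| ^+ n <= n`!%:R * (expR x + expR (- x)).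
Proof.
have H (y : R) : 0 <= y -> y ^+ n <= n`!%:R * expR y.
  move=> y0; case: n => [|n].
    by rewrite expr0 fact0 mul1r -[leLHS]addr0 (le_trans _ (expR_ge1Dx y))// lerD2l.
  rewrite -ler_pdivrMl ?ltr0n ?fact_gt0// mulrC.
  by apply: le_trans (expR_ge1Dxn n y0); rewrite lerDr.
apply: (le_trans (H `|x| (normr_ge0 x))).
rewrite ler_wpM2l ?ler0n//; case: (lerP 0 x) => x0.
  by rewrite (ger0_norm x0) lerDl expR_ge0.
by rewrite (ltr0_norm x0) lerDr expR_ge0.
Qed.

(* Completing the square: an exponential tilt of a centred Gaussian density is
   a shifted Gaussian density, up to a constant. *)
Lemma expR_normal_pdf t s x : s != 0 ->
  expR (t * x) * normal_pdf 0 s x =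
  expR (t ^+ 2 * s ^+ 2 / 2) * normal_pdf (t * s ^+ 2) s x.
Proof.
move=> s0; rewrite !normal_pdfE// /normal_fun mulrCA [RHS]mulrCA -!expRD.
by congr (_ * expR _); field.
Qed.

(** Tilts by t = 1 and t = -1. The majorant is both integrable, which gives the moments, and
    bounded, which makes the boundary terms vanish. *)
Lemma exprn_normal_pdf_le s x n : s != 0 ->
  `|x| ^+ n * normal_pdf 0 s x <= n`!%:R * expR (s ^+ 2 / 2) *
    (normal_pdf (s ^+ 2) s x + normal_pdf (- s ^+ 2) s x).
Proof.
move=> s0.
have := ler_wpM2r (normal_pdf_ge0 0 s x) (exprn_le_expR x n).
move/le_trans; apply.
have E1 := expR_normal_pdf 1 s x s0.
have E2 := expR_normal_pdf (-1) s x s0.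
rewrite !(mul1r, expr1n, mulN1r, sqrrN) in E1 E2.
by rewrite -[leLHS]mulrA mulrDl E1 E2 -mulrDr mulrA.
Qed.

Lemma integrable_exprn_normal_pdf s n : s != 0 ->
  mu.-integrable setT (fun x => (x ^+ n * normal_pdf 0 s x)%:E).
Proof.
move=> s0; set C := n`!%:R * expR (s ^+ 2 / 2).
apply: (@le_integrable _ _ _ mu _ _ _
  (fun x => C%:E * ((normal_pdf (s ^+ 2) s x)%:E
                   + (normal_pdf (- s ^+ 2) s x)%:E))%E) => //.
- apply/measurable_EFinP; apply: measurable_funM; first exact: measurable_funX.
  exact: measurable_normal_pdf.
- move=> x _ /=; rewrite lee_fin normrM normrX (ger0_norm (normal_pdf_ge0 _ _ _)).
  by apply: (le_trans (exprn_normal_pdf_le s x n s0)); exact: ler_norm.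
- by apply: integrableZl => //; apply: integrableD => //; exact: integrable_normal_pdf.
Qed.

(** At k = 0 the truncated exponent [k.-1] is harmless, since its coefficient is 0. *)
Lemma is_derive_exprn_normal_pdf s k x : s != 0 ->
  is_derive x 1 (fun y => y ^+ k * normal_pdf 0 s y)
    ((k%:R * x ^+ k.-1 - x ^+ k.+1 / s ^+ 2) * normal_pdf 0 s x).
Proof.
move=> s0.
have dX n : is_derive x 1 (fun y : R => y ^+ n) (n%:R * x ^+ n.-1).
  rewrite (_ : (fun y => _) = (@id R) ^+ n); last first.
    by apply/funext => y; rewrite exprfctE.
  by apply: is_derive_eq; rewrite /GRing.scale /= mulr1.
(* With the exponent written as c y^2, the density is a multiple of a composition to which the chain
   rule applies. *)
pose c := - (s ^+ 2 *+ 2)^-1.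
have dE : is_derive x 1 (expR \o (c \*: (fun y : R => y ^+ 2)))
    (expR (c * x ^+ 2) * (c * (2%:R * x ^+ 1))).
  exact: is_derive1_comp.
have -> : (fun y => y ^+ k * normal_pdf 0 s y) =
   normal_peak s \*: ((fun y : R => y ^+ k) * (expR \o (c \*: (fun y : R => y ^+ 2)))).
  apply/funext => y /=; rewrite normal_pdfE// /normal_fun subr0 mulrCA.
  rewrite (_ : - y ^+ 2 / _ = c * y ^+ 2) //.
  by rewrite /c mulNr mulrC mulNr.
apply: is_derive_eq; rewrite normal_pdfE// /normal_fun subr0 /GRing.scale /=.
have -> : - x ^+ 2 / (s ^+ 2 *+ 2) = c * x ^+ 2 by rewrite /c mulNr mulrC mulNr.
rewrite -[c *: _]/(c * x ^+ 2); set e := expR _.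
have -> : c = - (s ^+ 2)^-1 / 2 by rewrite /c; field.
rewrite [x ^+ k.+1]exprS expr1.
set a := x ^+ k; set b := x ^+ k.-1; set p := normal_peak s.
by field.
Qed.

(** The integral over a growing symmetric interval is a difference of boundary values of [F].
    Dominated convergence by the absolute value of [f] gives its limit, and the decay of [F] shows
    that this limit is 0. *)
Lemma integral_derive_exprn_normal_pdf s k : s != 0 ->
  (\int[mu]_x ((k%:R * x ^+ k.-1 - x ^+ k.+1 / s ^+ 2) * normal_pdf 0 s x)%:E
   = 0)%E.
Proof.
move=> s0.
pose f x := (k%:R * x ^+ k.-1 - x ^+ k.+1 / s ^+ 2) * normal_pdf 0 s x.
pose F x := x ^+ k * normal_pdf 0 s x.
have intf : mu.-integrable setT (EFin \o f).
  rewrite (_ : EFin \o f = (fun x =>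
     (k%:R)%:E * (x ^+ k.-1 * normal_pdf 0 s x)%:E
     - (s ^- 2)%:E * (x ^+ k.+1 * normal_pdf 0 s x)%:E)%E); last first.
    apply/funext => x /=; rewrite -!EFinM -EFinB; congr EFin.
    by rewrite /f mulrBl; congr (_ - _); rewrite !mulrA // [_ / _]mulrC.
  by apply: integrableB => //; apply: integrableZl => //;
    exact: integrable_exprn_normal_pdf.
have cf : continuous f.
  move=> x; apply: cvgM; last exact: continuous_normal_pdf.
  apply: cvgB; first by apply: cvgMr; exact: exprn_continuous.
  by apply: cvgMl; exact: exprn_continuous.
(* The shift to [n.+1] keeps the interval nondegenerate and its endpoints away from 0, where the
   bound C / |x| would fail. *)
pose A n : set R := `[(- n.+1%:R)%R, n.+1%:R]%classic.
pose f_ n := (EFin \o f) \_ (A n).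
have h1 : (\int[mu]_x f_ n x)%E @[n --> \oo] --> (\int[mu]_x (f x)%:E)%E.
  have [] // := @dominated_convergence _ _ _ mu setT measurableT f_ (EFin \o f)
    (abse \o (EFin \o f)).
  - move=> n; apply/(measurable_restrictT _ _).1; first exact: measurable_itv.
    by apply: measurable_funTS; exact: measurable_int intf.
  - exact: measurable_int intf.
  - apply: aeW => x _; apply: cvg_near_cst; near=> n.
    rewrite /f_ patchE mem_set// /A /= in_itv /= -ler_norml.
    rewrite (@le_trans _ _ n%:R) ?ler_nat//.
    by near: n; exact: nbhs_infty_ger.
  - exact: integrable_abse.
  - apply: aeW => x n _; rewrite /f_ patchE; case: ifP => // _.
    (* Outside [A n] the restriction takes the default value [point], which is 0 here. *)
    by rewrite (_ : point = 0%E)// abse0 abse_ge0.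
have h2 n : (\int[mu]_x f_ n x = (F n.+1%:R - F (- n.+1%:R))%:E)%E.
  have cF x : {for x, continuous F}.
    have dF := is_derive_exprn_normal_pdf s k x s0.
    exact/differentiable_continuous/derivable1_diffP/ex_derive.
  rewrite /f_ -integral_mkcond (@continuous_FTC2 _ f F)//.
  - by rewrite (@lt_trans _ _ 0)// ?oppr_lt0 ltr0n.
  - exact: continuous_subspaceT.
  - split.
    + by move=> x _; have dF := is_derive_exprn_normal_pdf s k x s0; exact: ex_derive.
    + exact/cvg_at_right_filter/cF.
    + exact/cvg_at_left_filter/cF.
  - by move=> x _; have dF := is_derive_exprn_normal_pdf s k x s0;
      rewrite derive1E derive_val.
have h3 : (F n.+1%:R - F (- n.+1%:R))%:E @[n --> \oo] --> 0%E.
  (* The bound of degree k + 1, with both shifted densities below their peak; the spare power of x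
     becomes the factor 1 / |x|. *)
  pose C := k.+1`!%:R * expR (s ^+ 2 / 2) * (normal_peak s + normal_peak s).
  have FC x : x != 0 -> `|F x| <= C / `|x|.
    move=> x0; rewrite ler_pdivlMr ?normr_gt0// mulrC /F normrM normrX mulrA -exprS.
    rewrite (ger0_norm (normal_pdf_ge0 _ _ _)).
    apply: (le_trans (exprn_normal_pdf_le s x k.+1 s0)).
    by rewrite ler_wpM2l ?mulr_ge0 ?ler0n ?expR_ge0// lerD// normal_pdf_ub.
  have dF n : `|F n.+1%:R - F (- n.+1%:R)| <= (C + C) * n.+1%:R^-1.
    rewrite (le_trans (ler_normB _ _))// mulrDl lerD//.
      by rewrite (le_trans (FC _ _)) ?pnatr_eq0// normr_nat.
    by rewrite (le_trans (FC _ _)) ?oppr_eq0 ?pnatr_eq0// normrN normr_nat.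
  apply: cvg_EFin; first exact: nearW.
  apply/norm_cvg0P; apply: (@squeeze_cvgr _ _ _ _ (fun=> 0)
    (fun n => (C + C) * n.+1%:R^-1)).
  - by apply: nearW => n; rewrite normr_ge0 dF.
  - exact: cvg_cst.
  - by rewrite -(mulr0 (C + C)); apply: cvgMr; exact: cvg_harmonic.
rewrite -/f; move: h1; rewrite (funext h2) => h1.
exact: cvg_unique h1 h3.
Unshelve. all: end_near.
Qed.

End gaussian_moments.

(** * Transfer of integrals from the sample space to the law of a variable *)

Section law.
Context {R : realType} {d : measure_display} {T : measurableType d}.
Variable P : probability T R.
Implicit Types (X : T -> R) (nu : {measure set (measurableTypeR R) -> \bar R}) (f : R -> \bar R).
Local Open Scope ereal_scope.

Lemma has_law_ge0_integral X nu f :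
  has_law P X nu -> measurable_fun [set: R] f -> (forall x, 0 <= f x) ->
  \int[P]_t f (X t) = \int[nu]_x f x.
Proof.
move=> [mX lX] mf f0.
have := @ge0_integral_pushforward _ _ _ (measurableTypeR R) _ _ mX P setT f measurableT mf
  (fun x _ => f0 x).
rewrite preimage_setT => <-; apply: eq_measure_integral => B mB _.
exact: lX.
Qed.

Lemma has_law_integrable X nu f :
  has_law P X nu -> nu.-integrable [set: R] f ->
  P.-integrable setT (f \o X).
Proof.
move=> lX /integrableP[mf fin]; apply/integrableP; split.
  by apply: measurableT_comp => //; case: lX.
rewrite (@has_law_ge0_integral X nu (abse \o f))//.
  exact: measurableT_comp.
by move=> x; exact: abse_ge0.
Qed.

Lemma has_law_integral X nu f :
  has_law P X nu -> nu.-integrable [set: R] f ->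
  \int[P]_t f (X t) = \int[nu]_x f x.
Proof.
move=> lX intf.
have [mX eX] := lX.
have mf := measurable_int _ intf.
have iX := has_law_integrable X nu f lX intf.
have := @integral_pushforward _ _ _ (measurableTypeR R) _ _ mX P setT f mf iX
  measurableT.
rewrite preimage_setT => <-; apply: eq_measure_integral => B mB _.
exact: eX.
Qed.

End law.

(** * Moments of the nondegenerate normal law *)

Section gauss_law_moments.
Context {R : realType}.
Local Open Scope ring_scope.
Notation mu := (@lebesgue_measure R).

Lemma integral_normal_prob (m s : R) (f : R -> \bar R) :
  (normal_prob m s).-integrable [set: R] f ->
  (\int[normal_prob m s]_x f x = \int[mu]_x (f x * (normal_pdf m s x)%:E))%E.
Proof.
move=> intf; have mf := measurable_int _ intf.
have dom := normal_prob_dominates m s.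
rewrite -(Radon_Nikodym_change_of_variables dom)//=.
apply: ae_eq_integral => //.
- by apply: emeasurable_funM => //; apply: (measurable_int mu).
- apply: emeasurable_funM => //; apply/measurable_EFinP.
  exact: measurable_normal_pdf.
- apply: ae_eqe_mul2l; apply: integral_ae_eq => //.
  + by apply: Radon_Nikodym_integrable; exact: dom.
  + by apply/measurable_EFinP; exact: measurable_normal_pdf.
  + by move=> E _ mE; rewrite -Radon_Nikodym_integral//; exact: dom.
Qed.

(** The nonnegative change of variables, applied to |x^n|, reduces this to integrability against the
    density. *)
Lemma integrable_exprn_normal_prob (s : R) n : s != 0 ->
  (normal_prob 0 s).-integrable [set: R] (fun x => (x ^+ n)%:E).
Proof.
move=> s0; apply/integrableP; split.
  by apply/measurable_EFinP; exact: measurable_funX.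
rewrite ge0_integral_normal_prob; last first.
- by move=> x; exact: abse_ge0.
- by apply: measurableT_comp => //; apply/measurable_EFinP; exact: measurable_funX.
have /integrableP[_] := integrable_exprn_normal_pdf s n s0.
congr (_ < _)%E; apply: eq_integral => x _.
by rewrite -EFinM /= normrM (ger0_norm (normal_pdf_ge0 _ _ _)).
Qed.

Definition normal_moment (s : R) n := (\int[normal_prob 0%R s]_x (x ^+ n))%R.

Lemma normal_moment_int (s : R) n : s != 0 ->
  (\int[mu]_x (x ^+ n * normal_pdf 0 s x)%:E = (normal_moment s n)%:E)%E.
Proof.
move=> s0; have i := integrable_exprn_normal_prob s n s0.
rewrite /normal_moment fineK; last exact: integrable_fin_num.
by rewrite integral_normal_prob.
Qed.

(** The vanishing integral of the derivative of x^k times the density reads k m_(k-1) = m_(k+1) /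
    s^2. The case k = 0 yields the zero mean. *)
Lemma normal_moment_rec (s : R) k : s != 0 ->
  normal_moment s k.+1 = k%:R * s ^+ 2 * normal_moment s k.-1.
Proof.
move=> s0.
have := integral_derive_exprn_normal_pdf s k s0.
rewrite (_ : (fun x => _) = (fun x =>
     (k%:R)%:E * (x ^+ k.-1 * normal_pdf 0 s x)%:E
     - (s ^- 2)%:E * (x ^+ k.+1 * normal_pdf 0 s x)%:E)%E); last first.
  apply/funext => x /=; rewrite -!EFinM -EFinB; congr EFin.
  by rewrite mulrBl; congr (_ - _); rewrite !mulrA // [_ / _]mulrC.
have i n := integrable_exprn_normal_pdf s n s0.
rewrite integralB//; [|exact: integrableZl..].
rewrite !integralZl// !normal_moment_int// -!EFinM -EFinB.
move=> -[] /subr0_eq E.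
by rewrite mulrAC E mulrC mulrA divff ?mul1r// sqrf_eq0.
Qed.

Lemma normal_moment0 (s : R) : normal_moment s 0 = 1.
Proof.
rewrite /normal_moment /Rintegral; under eq_integral do rewrite expr0.
by rewrite integral_cst//= mul1e probability_setT.
Qed.

End gauss_law_moments.

(** * Moments of a possibly degenerate Gaussian variable *)

Section gaussian_variable.
Context {R : realType} {d : measure_display} {T : measurableType d}.
Variables (P : probability T R) (X : T -> R) (v : R).
Hypotheses (v0 : 0 <= v) (lX : has_law P X (gauss_law v)).

Lemma gauss_law_integrable n :
  P.-integrable setT (fun t => (X t ^+ n)%:E).
Proof.
move: lX; rewrite /gauss_law; case: eqVneq => [_ lX0|vn0 lXn].
  apply: (has_law_integrable P X (@dirac _ (measurableTypeR R) 0 R)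
  (fun x : R => (x ^+ n)%:E) lX0).
  apply/integrableP; split.
    by apply/measurable_EFinP; exact: measurable_funX.
  rewrite integral_dirac//; last first.
    by apply: measurableT_comp => //; apply/measurable_EFinP; exact: measurable_funX.
  by rewrite diracT mul1e ltry.
apply: (has_law_integrable P X (normal_prob 0 (Num.sqrt v))
  (fun x : R => (x ^+ n)%:E) lXn).
by apply: integrable_exprn_normal_prob; rewrite gt_eqF// sqrtr_gt0 lt_neqAle eq_sym vn0.
Qed.

Lemma gauss_law_moments :
  [/\ (\int[P]_t X t)%R = 0, (\int[P]_t (X t ^+ 2))%R = v &
      (\int[P]_t (X t ^+ 4))%R = 3 * v ^+ 2].
Proof.
(* Each branch of [gauss_law] only has to supply its moment sequence: 0^n for the Dirac mass at 0,
   [normal_moment] otherwise. *)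
suff H : exists m : nat -> R, (forall n, (\int[P]_t (X t ^+ n))%R = m n) /\
    [/\ m 1%N = 0, m 2%N = v & m 4%N = 3 * v ^+ 2].
  have [m [mE [<- <- <-]]] := H; by split; rewrite -mE.
move: lX; rewrite /gauss_law; case: eqVneq => [-> lX0|vn0 lXn].
  exists (fun n => 0 ^+ n); split; last by rewrite !expr0n /= mulr0.
  move=> n; rewrite /Rintegral.
  rewrite (has_law_integral P X (@dirac _ (measurableTypeR R) 0 R)
  (fun x : R => (x ^+ n)%:E) lX0).
    rewrite integral_dirac ?diracT ?mul1e//.
    by apply/measurable_EFinP; exact: measurable_funX.
  apply/integrableP; split.
    by apply/measurable_EFinP; exact: measurable_funX.
  rewrite integral_dirac//; last first.
    by apply: measurableT_comp => //; apply/measurable_EFinP; exact: measurable_funX.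
  by rewrite diracT mul1e ltry.
have s0 : Num.sqrt v != 0 by rewrite gt_eqF// sqrtr_gt0 lt_neqAle eq_sym vn0.
exists (normal_moment (Num.sqrt v)); split.
  move=> n; rewrite /Rintegral.
  rewrite (has_law_integral P X (normal_prob 0 (Num.sqrt v))
  (fun x : R => (x ^+ n)%:E) lXn)//.
  exact: integrable_exprn_normal_prob.
rewrite !normal_moment_rec//= normal_moment0 sqr_sqrtr// !mul0r !mul1r mulr1.
by split => //; rewrite expr2 mulrA.
Qed.

End gaussian_variable.

(** * Variables with moments of all orders *)

Section finite_moments.
Context {R : realType} {d : measure_display} {T : measurableType d}.
Variable P : probability T R.
Implicit Types (X Y : T -> R) (c : R).

(** Asking for all orders makes the class closed under products as well as sums, so every later
    integrability condition follows from the shape of the expression. *)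
Definition finite_moments X :=
  measurable_fun setT X /\
  forall n, P.-integrable setT (fun t => (X t ^+ n)%:E).

Lemma finite_moments_integrable X :
  finite_moments X -> P.-integrable setT (EFin \o X).
Proof. by move=> [_ /(_ 1%N)]. Qed.

Lemma finite_moments_cst c : finite_moments (fun=> c).
Proof.
split=> [|n]; first exact: measurable_cst.
by apply: (finite_measure_integrable_cst P (c ^+ n)).
Qed.

(** From a b <= a^2 + b^2 with a = |X^n| and b = |Y^n|: moments of order 2n of the factors control
    the moment of order n of the product. *)
Lemma finite_momentsM X Y :
  finite_moments X -> finite_moments Y -> finite_moments (X \* Y).
Proof.
move=> [mX iX] [mY iY]; split=> [|n]; first exact: measurable_funM.
apply: (@le_integrable _ _ _ P _ measurableT _
  (fun t => (X t ^+ (2 * n))%:E + (Y t ^+ (2 * n))%:E)%E).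
- by apply/measurable_EFinP; apply: measurable_funX; exact: measurable_funM.
- move=> t _; rewrite -EFinD !abse_EFin lee_fin /= !(mulnC 2%N) !exprM exprMn.
  rewrite normrM (ger0_norm (addr_ge0 (sqr_ge0 _) (sqr_ge0 _))).
  rewrite -(real_normK (num_real (X t ^+ n))) -(real_normK (num_real (Y t ^+ n))).
  set a := `|_|; set b := `|_|.
  have a0 : 0 <= a by exact: normr_ge0.
  have b0 : 0 <= b by exact: normr_ge0.
  nra.
- by apply: integrableD.
Qed.

(** The sum |X| + |Y| is at most twice the larger of the two, whose n-th power is at most |X|^n +
    |Y|^n. *)
Lemma finite_momentsD X Y :
  finite_moments X -> finite_moments Y -> finite_moments (X \+ Y).
Proof.
move=> [mX iX] [mY iY]; split=> [|n]; first exact: measurable_funD.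
apply: (@le_integrable _ _ _ P _ measurableT _
  (fun t => (2 ^+ n)%:E * (`|(X t ^+ n)%:E| + `|(Y t ^+ n)%:E|))%E).
- by apply/measurable_EFinP; apply: measurable_funX; exact: measurable_funD.
- move=> t _ /=; rewrite lee_fin !normrX.
  rewrite [leRHS]ger0_norm; last by rewrite mulr_ge0 ?exprn_ge0// addr_ge0 ?exprn_ge0.
  rewrite (@le_trans _ _ ((`|X t| + `|Y t|) ^+ n))//.
    by rewrite lerXn2r ?nnegrE ?addr_ge0// ler_normD.
  wlog XY : X Y {mX iX mY iY} / `|X t| <= `|Y t|.
    move=> H; have [XY|/ltW YX] := leP `|X t| `|Y t|; first exact: H.
    by have := H _ _ YX; rewrite [`|Y t| + _]addrC [_ ^+ n + _]addrC.
  rewrite (@le_trans _ _ ((2 * `|Y t|) ^+ n))//.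
    by rewrite lerXn2r ?nnegrE ?addr_ge0 ?mulr_ge0// mulr_natl mulr2n lerD2r.
  by rewrite exprMn ler_wpM2l ?exprn_ge0// lerDr exprn_ge0.
- by apply: integrableZl => //; apply: integrableD => //; exact: integrable_abse.
Qed.

Lemma finite_momentsZ c X : finite_moments X -> finite_moments (fun t => c * X t).
Proof. by move=> mX; apply: finite_momentsM => //; exact: finite_moments_cst. Qed.

Lemma finite_moments_sum (I : Type) (s : seq I) (F : I -> T -> R) :
  (forall i, finite_moments (F i)) -> finite_moments (fun t => \sum_(i <- s) F i t).
Proof.
move=> mF; elim: s => [|i s IH].
  by under eq_fun do rewrite big_nil; exact: finite_moments_cst.
under eq_fun do rewrite big_cons.
exact: finite_momentsD (mF i) IH.
Qed.

Lemma finite_moments_gauss X v : 0 <= v ->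
  has_law P X (gauss_law v) -> finite_moments X.
Proof. by move=> v0 lX; split; [case: lX|exact: (gauss_law_integrable P X v)]. Qed.

Lemma finite_moments_RintegralD X Y : finite_moments X -> finite_moments Y ->
  (\int[P]_t (X t + Y t) = \int[P]_t X t + \int[P]_t Y t)%R.
Proof. by move=> mX mY; apply: RintegralD => //; exact: finite_moments_integrable. Qed.

Lemma finite_moments_RintegralZ c X : finite_moments X ->
  (\int[P]_t (c * X t) = c * \int[P]_t X t)%R.
Proof. by move=> mX; apply: RintegralZl => //; exact: finite_moments_integrable. Qed.

Lemma Rintegral_probability_cst c : (\int[P]_t c = c)%R.
Proof.
by rewrite /Rintegral integral_cst//= probability_setT mule1.
Qed.

Lemma finite_moments_Rintegral_sum (I : Type) (s : seq I) (F : I -> T -> R) :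
  (forall i, finite_moments (F i)) ->
  (\int[P]_t (\sum_(i <- s) F i t) = \sum_(i <- s) \int[P]_t F i t)%R.
Proof.
move=> mF; elim: s => [|i s IH].
  by rewrite big_nil; under eq_Rintegral do rewrite big_nil; rewrite Rintegral_probability_cst.
rewrite big_cons -IH; under eq_Rintegral do rewrite big_cons.
by apply: finite_moments_RintegralD => //; exact: finite_moments_sum.
Qed.

End finite_moments.

(** * From independence of events to products of expectations *)

Section independence.
Context {R : realType} {d : measure_display} {T : measurableType d}.
Variable P : probability T R.
Local Open Scope ereal_scope.

(** Both sides are finite measures in [A]: the restriction of [P] to [A'] and a multiple of [P].
    They agree on the pi-system [G], hence on the sigma-algebra it generates. *)
Lemma sigma_algebra_indepl (G : set (set T)) (A' : set T) :
  G `<=` measurable -> setI_closed G -> G setT -> measurable A' ->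
  (forall A, G A -> P (A `&` A') = P A * P A') ->
  forall A, <<s G >> A -> P (A `&` A') = P A * P A'.
Proof.
move=> Gm GI GT mA' H A sA.
have fA' : P A' \is a fin_num by exact: fin_num_measure.
pose c := NngNum (fine_ge0 (measure_ge0 P A')).
transitivity (mscale c P A); last by rewrite /mscale/= fineK// muleC.
transitivity (mrestr P mA' A); first by [].
(* Since [G] contains [setT], the constant sequence serves as the exhausting cover by sets of finite
   mass. *)
apply: (g_sigma_algebra_measure_unique G Gm (fun=> setT)) => //.
- by rewrite bigcup_const//; exists 0%N.
- move=> B GB; change (P (B `&` A') = (fine (P A'))%:E * P B).
  by rewrite fineK// muleC; exact: H.
- move=> _; change (P (setT `&` A') < +oo).
  by rewrite setTI ltey_eq fA'.
Qed.

(** One side is extended at a time, with the set on the other side held fixed. *)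
Lemma sigma_algebra_indep (G G' : set (set T)) :
  G `<=` measurable -> setI_closed G -> G setT ->
  G' `<=` measurable -> setI_closed G' -> G' setT ->
  (forall A A', G A -> G' A' -> P (A `&` A') = P A * P A') ->
  forall A A', <<s G >> A -> <<s G' >> A' -> P (A `&` A') = P A * P A'.
Proof.
move=> Gm GI GT Gm' GI' GT' H A A' sA sA'.
have mA : measurable A.
  exact: (smallest_sub (@sigma_algebra_measurable _ T) Gm).
rewrite setIC muleC; apply: (sigma_algebra_indepl G') => //.
move=> {A' sA'}A' GA'; rewrite setIC muleC.
apply: (sigma_algebra_indepl G) => //; first exact: Gm'.
by move=> {A sA mA}A GA; exact: H.
Qed.

Lemma expectation_indepM (X Y : T -> R) :
  finite_moments P X -> finite_moments P Y ->
  (forall B B' : set R, measurable B -> measurable B' ->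
    P (X @^-1` B `&` Y @^-1` B') = P (X @^-1` B) * P (Y @^-1` B')) ->
  (\int[P]_t (X t * Y t) = (\int[P]_t X t) * \int[P]_t Y t)%R.
Proof.
move=> mX mY XY; have [mfX _] := mX; have [mfY _] := mY.
have iXY := finite_moments_integrable _ _ (finite_momentsM _ _ _ mX mY).
have iX := finite_moments_integrable _ _ mX.
have iY := finite_moments_integrable _ _ mY.
pose X' : {mfun T >-> measurableTypeR R} :=
  HB.pack X (isMeasurableFun.Build _ _ _ (measurableTypeR R) _ mfX).
pose Y' : {mfun T >-> measurableTypeR R} :=
  HB.pack Y (isMeasurableFun.Build _ _ _ (measurableTypeR R) _ mfY).
pose muX := distribution P X'; pose muY := distribution P Y'.
have mXY : measurable_fun [set: T] (fun t => (X' t, Y' t)).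
  exact: measurable_fun_pair.
pose XY' : {mfun T >-> (measurableTypeR R * measurableTypeR R)%type} :=
  HB.pack (fun t => (X' t, Y' t)) (isMeasurableFun.Build _ _ _ _ _ mXY).
pose muXY := distribution P XY'.
(* By [XY] the joint law and the product of the marginals agree on rectangles, which determine a
   product measure. *)
have E A : measurable A -> (muX \x muY) A = muXY A.
  by move=> mA; apply: (@product_measure_unique _ _ _ _ _ muX muY muXY).
pose f (z : (measurableTypeR R * measurableTypeR R)%type) : \bar R := (z.1 * z.2)%:E.
have mf : measurable_fun setT f.
  apply/measurable_EFinP; apply: measurable_funM.
    exact: measurable_fst.
  exact: measurable_snd.
(* Fubini needs integrability over the product; it is carried over from that of [X] times [Y]
   through the joint law. *)
have intf : (muX \x muY).-integrable setT f.
  apply/integrableP; split => //.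
  rewrite (eq_measure_integral muXY); last by move=> A mA _; exact: E.
  rewrite ge0_integral_distribution//; last exact: measurableT_comp.
  by have /integrableP[] := iXY.
have idX : muX.-integrable setT (fun x : measurableTypeR R => (x : R)%:E).
  by apply: integrable_pushforward => //; exact/measurable_EFinP.
have idY : muY.-integrable setT (fun x : measurableTypeR R => (x : R)%:E).
  by apply: integrable_pushforward => //; exact/measurable_EFinP.
have EX : \int[muX]_x (x : R)%:E = \int[P]_t (X t)%:E.
  by rewrite integral_distribution//; exact/measurable_EFinP.
have EY : \int[muY]_x (x : R)%:E = \int[P]_t (Y t)%:E.
  by rewrite integral_distribution//; exact/measurable_EFinP.
have fY : \int[P]_t (Y t)%:E \is a fin_num by exact: integrable_fin_num.
have fX : \int[P]_t (X t)%:E \is a fin_num by exact: integrable_fin_num.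
suff : \int[P]_t (X t * Y t)%:E = \int[P]_t (X t)%:E * \int[P]_t (Y t)%:E.
  by rewrite /Rintegral => ->; rewrite fineM.
transitivity (\int[muXY]_z f z).
  by rewrite integral_distribution.
rewrite (eq_measure_integral (muX \x muY)); last by move=> A mA _; exact/esym/E.
rewrite -integral12_prod_meas1//.
transitivity (\int[muX]_x ((x : R)%:E * \int[P]_t (Y t)%:E)).
  apply: eq_integral => x _; rewrite /fubini_F /f /=.
  under eq_integral do rewrite EFinM.
  by rewrite integralZl// EY.
by rewrite -(fineK fY) integralZr// EX.
Qed.

End independence.

(** * Independence of functions of disjoint families of blocks *)

Section independent_blocks.
Context {R : realType} {d : measure_display} {T : measurableType d}.
Variables (P : probability T R) (K I : finType) (blk : K -> I).
Variable (C : K -> T -> R).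
Hypothesis indC : indep_blocks P blk C.
Implicit Types (J : pred I) (X Y : T -> R).

Let bigcapC (D : set K) (B : K -> set R) := \bigcap_(k in D) (C k @^-1` B k).

(** The sets [B k] range over all of [K], with [setT] off [J], so that rectangles for different
    families intersect coordinatewise and [indC] applies to the result. *)
Definition block_rectangle J : set (set T) :=
  [set A | exists B : K -> set R, [/\ forall k, measurable (B k),
     forall k, ~~ J (blk k) -> B k = setT & A = bigcapC [set: K] B]].

(** The sample space with the sigma-algebra of the blocks in [J]. As it is a measurable type, the
    usual closure rules for measurable functions prove [block_measurable]. *)
Definition block_sigma J := g_sigma_algebraType (block_rectangle J).

Definition block_measurable J X :=
  measurable_fun [set: block_sigma J] (X : block_sigma J -> R).

Lemma measurable_bigcapC (D : set K) (B : K -> set R) :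
  (forall k, measurable (B k)) -> measurable (bigcapC D B).
Proof.
move=> mB; apply: fin_bigcap_measurable => // k _.
by rewrite -[X in measurable X]setTI; apply: indC.1.
Qed.

Lemma bigcapCI (D : set K) (B B' : K -> set R) :
  bigcapC D B `&` bigcapC D B' = bigcapC D (fun k => B k `&` B' k).
Proof.
apply/seteqP; split=> [t [BT BT'] k Dk|t H]; first by split; [exact: BT|exact: BT'].
by split=> k Dk; have [] := H k Dk.
Qed.

Lemma block_rectangle_measurable J : block_rectangle J `<=` measurable.
Proof. by move=> _ [B [mB _ ->]]; exact: measurable_bigcapC. Qed.

Lemma block_rectangleI J : setI_closed (block_rectangle J).
Proof.
move=> _ _ [B [mB BT ->]] [B' [mB' BT' ->]].
exists (fun k => B k `&` B' k); split=> [k|k nJ|].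
- exact: measurableI.
- by rewrite BT// BT'// setIT.
- exact: bigcapCI.
Qed.

Lemma block_rectangleT J : block_rectangle J setT.
Proof.
exists (fun=> setT); split=> //.
by apply/seteqP; split=> t.
Qed.

(** The product formula over blocks splits factor by factor: in each block at most one of the two
    rectangles imposes a condition, and the other contributes probability 1. *)
Lemma block_rectangle_indep J J' : (forall i, ~~ (J i && J' i)) ->
  forall A A', block_rectangle J A -> block_rectangle J' A' ->
  P (A `&` A') = (P A * P A')%E.
Proof.
move=> JJ' _ _ [B [mB BT ->]] [B' [mB' BT' ->]].
rewrite bigcapCI !indC.2//; last by move=> k; exact: measurableI.
rewrite -big_split /=; apply: eq_bigr => i _.
have full (B0 : K -> set R) (J0 : pred I) : (forall k, ~~ J0 (blk k) -> B0 k = setT) ->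
    ~~ J0 i -> bigcapC [set k | blk k = i] B0 = setT.
  move=> BT0 nJ0; apply/seteqP; split=> t // _ k /= ki.
  by rewrite BT0 ?ki.
rewrite -/(bigcapC _ _) -/(bigcapC _ B) -/(bigcapC _ B') -bigcapCI.
have [Ji|nJi] := boolP (J i).
  by rewrite (full B' J')// ?setIT ?probability_setT ?mule1//;
    have := JJ' i; rewrite Ji.
by rewrite (full B J)// setTI probability_setT mul1e.
Qed.

(** A preimage under one coordinate is a rectangle constrained in that coordinate alone. *)
Lemma block_measurable_coord J k : J (blk k) -> block_measurable J (C k).
Proof.
move=> Jk _ B mB; rewrite setTI; apply: sub_sigma_algebra.
exists (fun k' => if k' == k then B else setT); split=> [k'|k'|].
- by case: ifP.
- by move=> nJ; case: eqP nJ => // ->; rewrite Jk.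
- apply/seteqP; split=> [t Bt k' _ /=|t /(_ k Logic.I) /=]; last by rewrite eqxx.
  by case: eqP => // ->.
Qed.

Lemma expectation_blocksM J J' X Y :
  (forall i, ~~ (J i && J' i)) ->
  block_measurable J X -> block_measurable J' Y ->
  finite_moments P X -> finite_moments P Y ->
  (\int[P]_t (X t * Y t) = (\int[P]_t X t) * \int[P]_t Y t)%R.
Proof.
move=> JJ' mX mY fX fY; apply: expectation_indepM => // B B' mB mB'.
apply: (sigma_algebra_indep P (block_rectangle J) (block_rectangle J')).
- exact: block_rectangle_measurable.
- exact: block_rectangleI.
- exact: block_rectangleT.
- exact: block_rectangle_measurable.
- exact: block_rectangleI.
- exact: block_rectangleT.
- exact: block_rectangle_indep.
- by have := mX measurableT B mB; rewrite setTI.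
- by have := mY measurableT B' mB'; rewrite setTI.
Qed.

End independent_blocks.
Arguments block_measurable {R d T K I} blk C J X.
Arguments block_measurable_coord {R d T K I} blk C J k.

(** * Matrix algebra of the attention model *)

Section model.
Context {R : realType}.

(** [W_PV] keeps only the label row and [W_KQ] only the inputs. The label 0 of the query kills both
    the residual term and the attention of the query to itself. *)
Lemma lsa_Ehat (d M : nat) (U : 'M[R]_d) (u : R) (X : 'M[R]_(d, M))
    (xq : 'cV[R]_d) (y : 'rV[R]_M) :
  lsa (W_PV d u) (W_KQ U) (Ehat X xq y) =
  u * M%:R^-1 * (y *m X^T *m U *m xq) 0 0.
Proof.
rewrite /lsa /W_PV /W_KQ /Ehat.
(* Only the values of the two indices are kept, so that they can be generalised and the casts
   eliminated by case analysis on the equalities. *)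
have : (ord_max : 'I_d.+1) = d :> nat by [].
have : (ord_max : 'I_M.+1) = M :> nat by [].
move: (ord_max : 'I_d.+1) (ord_max : 'I_M.+1).
case: _ / (addn1 d); case: _ / (addn1 M) => i0 j0 jM id.
rewrite !castmx_id.
have -> : i0 = rshift d (0 : 'I_1) by apply/val_inj; rewrite /= addn0.
have -> : j0 = rshift M (0 : 'I_1) by apply/val_inj; rewrite /= addn0.
rewrite tr_block_mx !mulmx_block scale_block_mx mulmx_block add_block_mx block_mxEdr.
rewrite !(mul0mx, mulmx0, addr0, add0r) mul_scalar_mx -!scalemxAl -!scalemxAr.
by rewrite scalerA 2!mulmxA [LHS]mxE.
Qed.

Lemma diagvM n (a b : 'I_n -> R) :
  diagv a *m diagv b = diagv (fun i => a i * b i).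
Proof.
rewrite /diagv mulmx_diag; congr diag_mx; apply/rowP => i; by rewrite !mxE.
Qed.

Lemma qform_diagv n (a : 'I_n -> R) (x : 'cV[R]_n) :
  qform (diagv a) x = \sum_i a i * x i 0 ^+ 2.
Proof.
rewrite /qform mul_mx_diag !mxE; apply: eq_bigr => i _.
by rewrite !mxE expr2 mulrAC mulrA [a i * _]mulrC mulrAC.
Qed.

Lemma mxtrace_diagv n (a : 'I_n -> R) : \tr (diagv a) = \sum_i a i.
Proof. by rewrite mxtrace_diag; apply: eq_bigr => i _; rewrite mxE. Qed.

Lemma qform_congr n (A Q : 'M[R]_n) (x : 'cV[R]_n) :
  qform (Q *m A *m Q^T) x = qform A (Q^T *m x).
Proof. by rewrite /qform trmx_mul trmxK !mulmxA. Qed.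

Lemma mul_row_diag_col n (a : 'rV[R]_n) (v : 'I_n -> R) (b : 'cV[R]_n) :
  (a *m diagv v *m b) 0 0 = \sum_i a 0 i * v i * b i 0.
Proof. by rewrite mul_mx_diag !mxE; apply: eq_bigr => i _; rewrite !mxE. Qed.

End model.

(** * Rotation and joint moments of Gaussian vectors *)

Section gaussian_vectors.
Context {R : realType} {d : measure_display} {T : measurableType d}.
Variable P : probability T R.

(** The combination of the rotated coordinates with weights a is the combination of the original
    ones with weights Q a. *)
Lemma gaussian_vector_mul n (X : 'I_n -> T -> R) (A Q : 'M[R]_n) :
  Q^T *m Q = 1%:M -> gaussian_vector P X (Q *m A *m Q^T) ->
  gaussian_vector P (fun k t => \sum_i Q i k * X i t) A.
Proof.
move=> QQ [mX lX]; split=> [k|a].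
  by apply: measurable_sum => i; apply: measurable_funM => //; exact: measurable_cst.
have := lX (Q *m a); rewrite qform_congr mulmxA QQ mul1mx.
congr (has_law P _ _); apply/funext => t.
under [RHS]eq_bigr do rewrite mulr_sumr.
rewrite exchange_big /=; apply: eq_bigr => i _.
rewrite mxE mulr_suml; apply: eq_bigr => k _.
by rewrite mulrA [a k 0 * _]mulrC.
Qed.

Variables (n : nat) (lam : 'I_n -> R) (z : 'I_n -> T -> R).
Hypotheses (lam0 : forall i, 0 <= lam i) (gz : gaussian_vector P z (diagv lam)).
Implicit Types a b : 'I_n -> R.

Definition linear_form a t := \sum_k a k * z k t.
(** The covariance of the linear forms with weights [a] and [b]. *)
Definition wdot a b := \sum_k lam k * a k * b k.

Lemma wdotD a b : wdot (a \+ b) (a \+ b) = wdot a a + 2 * wdot a b + wdot b b.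
Proof.
rewrite /wdot mulr_sumr -!big_split; apply: eq_bigr => k _ /=; ring.
Qed.

Lemma wdotB a b : wdot (a \- b) (a \- b) = wdot a a - 2 * wdot a b + wdot b b.
Proof.
rewrite /wdot mulr_sumr -sumrB -!big_split; apply: eq_bigr => k _ /=; ring.
Qed.

Lemma linear_formD a b t : linear_form (a \+ b) t = linear_form a t + linear_form b t.
Proof. by rewrite /linear_form -big_split; apply: eq_bigr => k _ /=; rewrite mulrDl. Qed.

Lemma linear_formB a b t : linear_form (a \- b) t = linear_form a t - linear_form b t.
Proof. by rewrite /linear_form -sumrB; apply: eq_bigr => k _ /=; rewrite mulrBl. Qed.

Lemma wdot_ge0 a : 0 <= wdot a a.
Proof. by apply: sumr_ge0 => k _; rewrite -mulrA mulr_ge0// -expr2 sqr_ge0. Qed.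

Lemma linear_form_law a : has_law P (linear_form a) (gauss_law (wdot a a)).
Proof.
have := gz.2 (\col_k a k); rewrite qform_diagv.
have -> : \sum_i lam i * (\col_k a k) i 0 ^+ 2 = wdot a a.
  by apply: eq_bigr => i _; rewrite mxE expr2 mulrA.
congr (has_law P _ _); apply/funext => t.
by apply: eq_bigr => i _; rewrite mxE.
Qed.

Lemma finite_moments_linear_form a : finite_moments P (linear_form a).
Proof. exact: finite_moments_gauss (wdot_ge0 a) (linear_form_law a). Qed.

Let moments a := gauss_law_moments _ _ _ (wdot_ge0 a) (linear_form_law a).
Let fm := finite_moments_linear_form.

(** Polarisation: the second moments of the forms for a, b and a + b are known, since each form is a
    Gaussian variable. *)
Lemma expectation_linear_formM a b :
  (\int[P]_t (linear_form a t * linear_form b t))%R = wdot a b.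
Proof.
have fD a' b' : finite_moments P (fun t => linear_form a' t * linear_form b' t).
  exact: finite_momentsM (fm a') (fm b').
have f2 a' : finite_moments P (fun t => linear_form a' t ^+ 2) := fD a' a'.
have [_ mD _] := moments (a \+ b); have [_ ma _] := moments a.
have [_ mb _] := moments b.
have : (\int[P]_t (linear_form (a \+ b) t ^+ 2) =
   \int[P]_t (linear_form a t ^+ 2) +
   (2 * \int[P]_t (linear_form a t * linear_form b t) +
    \int[P]_t (linear_form b t ^+ 2)))%R.
  rewrite -finite_moments_RintegralZ// -!finite_moments_RintegralD//;
    do ?[exact: f2|exact: finite_momentsZ|apply: finite_momentsD].
  by apply: eq_Rintegral => t _; rewrite linear_formD; ring.
rewrite mD ma mb wdotD; lra.
Qed.

(* Isserlis' formula, obtained by polarisation from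
   12 x^2 y^2 = (x + y)^4 + (x - y)^4 - 2 x^4 - 2 y^4. *)
Lemma expectation_linear_form2M2 a b :
  (\int[P]_t ((linear_form a t * linear_form b t) ^+ 2))%R =
  wdot a a * wdot b b + 2 * wdot a b ^+ 2.
Proof.
have f4 a' : finite_moments P (fun t => linear_form a' t ^+ 4).
  exact: finite_momentsM (fm a') (finite_momentsM _ _ _ (fm a')
    (finite_momentsM _ _ _ (fm a') (fm a'))).
have [_ _ mD] := moments (a \+ b); have [_ _ mB] := moments (a \- b).
have [_ _ ma] := moments a; have [_ _ mb] := moments b.
have : (\int[P]_t ((linear_form a t * linear_form b t) ^+ 2) =
   12^-1 * \int[P]_t (linear_form (a \+ b) t ^+ 4) +
   (12^-1 * \int[P]_t (linear_form (a \- b) t ^+ 4) +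
   ((- 6^-1) * \int[P]_t (linear_form a t ^+ 4) +
   (- 6^-1) * \int[P]_t (linear_form b t ^+ 4))))%R.
  rewrite -!finite_moments_RintegralZ// -!finite_moments_RintegralD//;
    do ?[exact: finite_momentsZ|apply: finite_momentsD].
  by apply: eq_Rintegral => t _; rewrite linear_formD linear_formB; field.
by move=> ->; rewrite mD mB ma mb wdotD wdotB; field.
Qed.

Definition coord k : 'I_n -> R := fun i => (i == k)%:R.

Lemma linear_form_coord k : linear_form (coord k) = z k.
Proof.
apply/funext => t; rewrite /linear_form (bigD1 k)//= /coord eqxx mul1r.
by rewrite big1 ?addr0// => i /negbTE ->; rewrite mul0r.
Qed.

Lemma wdot_coordl k a : wdot (coord k) a = lam k * a k.
Proof.
rewrite /wdot (bigD1 k)//= /coord eqxx mulr1 big1 ?addr0// => i /negbTE ->.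
by rewrite mulr0 mul0r.
Qed.

Lemma finite_moments_gaussian k : finite_moments P (z k).
Proof. by rewrite -linear_form_coord. Qed.

Lemma expectation_gaussianM k l :
  (\int[P]_t (z k t * z l t) = if k == l then lam k else 0)%R.
Proof.
have := expectation_linear_formM (coord k) (coord l).
rewrite !linear_form_coord wdot_coordl => ->.
by rewrite /coord; case: eqP => _; rewrite ?mulr1 ?mulr0.
Qed.

Lemma expectation_gaussian_linear_form k a :
  (\int[P]_t (z k t * linear_form a t) = lam k * a k)%R.
Proof.
have := expectation_linear_formM (coord k) a.
by rewrite linear_form_coord wdot_coordl.
Qed.

Lemma expectation_gaussian_linear_form2 k a :
  (\int[P]_t ((z k t * linear_form a t) ^+ 2) =
   lam k * wdot a a + 2 * (lam k * a k) ^+ 2)%R.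
Proof.
have := expectation_linear_form2M2 (coord k) a.
by rewrite linear_form_coord !wdot_coordl /coord eqxx mulr1.
Qed.

End gaussian_vectors.
Arguments linear_form {R d T n} z a t.
Arguments wdot {R n} lam a b.

(** * Second moments of sums, affine images and bilinear forms; the error in rotated coordinates *)

Section prediction_error.
Context {R : realType} {d : measure_display} {T : measurableType d}.
Variable P : probability T R.

(** The square has M diagonal terms q and M (M - 1) off-diagonal terms mu^2, regrouped as M
    variances plus the squared mean. *)
Lemma expectation_sumX2 (M : nat) (p : 'I_M -> T -> R) (mu q : R) :
  (forall j, finite_moments P (p j)) ->
  (forall j, \int[P]_t (p j t ^+ 2) = q)%R ->
  (forall i j, i != j -> \int[P]_t (p i t * p j t) = mu ^+ 2)%R ->
  (\int[P]_t ((\sum_j p j t) ^+ 2) = M%:R * (q - mu ^+ 2) + (M%:R * mu) ^+ 2)%R.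
Proof.
move=> fp pq pmu.
have fpp i j : finite_moments P (fun t => p i t * p j t).
  exact: finite_momentsM (fp i) (fp j).
under eq_Rintegral => t _.
  rewrite expr2 mulr_suml; under eq_bigr do rewrite mulr_sumr; over.
rewrite finite_moments_Rintegral_sum; last by move=> i; exact: finite_moments_sum.
have E i : (\int[P]_t (\sum_j p i t * p j t))%R = (q - mu ^+ 2) + M%:R * mu ^+ 2.
  rewrite finite_moments_Rintegral_sum//.
  (* An indicator merges the diagonal and off-diagonal cases into one summand. *)
  rewrite (eq_bigr (fun j => (q - mu ^+ 2) * (j == i)%:R + mu ^+ 2)); last first.
    move=> j _; case: eqVneq => [->|ij]; last by rewrite mulr0 add0r pmu// eq_sym.
    by rewrite mulr1 subrK -(pq i).
  rewrite big_split /= sumr_const card_ord mulr_natl; congr (_ + _).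
  rewrite (bigD1 i)//= eqxx mulr1 big1 ?addr0// => j /negbTE ->.
  by rewrite mulr0.
under eq_bigr do rewrite E.
by rewrite sumr_const card_ord -[LHS]mulr_natl; ring.
Qed.

(** The decomposition into variance and squared bias. *)
Lemma expectation_affineX2 (S : T -> R) (a b m q : R) :
  finite_moments P S -> (\int[P]_t S t = m)%R -> (\int[P]_t (S t ^+ 2) = q)%R ->
  (\int[P]_t ((a * S t - b) ^+ 2) = a ^+ 2 * (q - m ^+ 2) + (a * m - b) ^+ 2)%R.
Proof.
move=> fS Sm Sq.
have fS2 : finite_moments P (fun t => S t ^+ 2) by exact: (finite_momentsM P S S).
transitivity ((a ^+ 2 * \int[P]_t (S t ^+ 2) +
  ((- 2 * a * b) * \int[P]_t S t + b ^+ 2))%R).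
  rewrite -!finite_moments_RintegralZ//.
  rewrite -[X in _ + (_ + X)](Rintegral_probability_cst P) -!finite_moments_RintegralD//;
    do ?[exact: finite_moments_cst|exact: finite_momentsZ|apply: finite_momentsD].
  by apply: eq_Rintegral => t _; ring.
by rewrite Sm Sq; ring.
Qed.

(** Here [g] is the query and [G] the coefficient error. Uncorrelated coordinates of [g] remove all
    cross terms, whatever the correlations within [G]. *)
Lemma expectation_bilinearX2 (n : nat) (g G : 'I_n -> T -> R) (lam : 'I_n -> R) :
  (forall k, finite_moments P (g k)) -> (forall k, finite_moments P (G k)) ->
  (forall k l, \int[P]_t (g k t * g l t) = if k == l then lam k else 0)%R ->
  (forall k l, \int[P]_t ((g k t * g l t) * (G k t * G l t)) =
     (\int[P]_t (g k t * g l t)) * \int[P]_t (G k t * G l t))%R ->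
  (\int[P]_t ((\sum_k g k t * G k t) ^+ 2) =
   \sum_k lam k * \int[P]_t (G k t ^+ 2))%R.
Proof.
move=> fg fG gg ind.
have f k l : finite_moments P (fun t => (g k t * g l t) * (G k t * G l t)).
  by apply: finite_momentsM; exact: finite_momentsM.
under eq_Rintegral => t _.
  rewrite expr2 mulr_suml; under eq_bigr do rewrite mulr_sumr.
  under eq_bigr do under eq_bigr do rewrite mulrACA. over.
rewrite finite_moments_Rintegral_sum; last by move=> i; exact: finite_moments_sum.
apply: eq_bigr => k _; rewrite finite_moments_Rintegral_sum// (bigD1 k)//= ind gg eqxx.
rewrite big1 ?addr0// => l kl.
by rewrite ind gg eq_sym (negbTE kl) mul0r.
Qed.

End prediction_error.

(** Moving the factors Q onto the data leaves a diagonal matrix between rotated vectors, and c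
    cancels against its inverse. *)
Lemma prediction_errorE (R : realType) (d M : nat) (Q : 'M[R]_d) (v : 'I_d -> R)
    (c : R) (b : 'cV[R]_d) (X : 'M[R]_(d, M)) (xq : 'cV[R]_d) (y : 'rV[R]_M) :
  c != 0 ->
  lsa (W_PV d c^-1) (W_KQ (c *: (Q *m diagv v *m Q^T))) (Ehat X xq y)
    - ((Q *m b)^T *m xq) 0 0 =
  \sum_k (Q^T *m xq) k 0 *
    (v k / M%:R * (\sum_j (Q^T *m X) k j * y 0 j) - b k 0).
Proof.
move=> c0; rewrite lsa_Ehat -scalemxAr -scalemxAl mxE.
have -> : ((Q *m b)^T *m xq) 0 0 = \sum_k b k 0 * (Q^T *m xq) k 0.
  by rewrite trmx_mul -mulmxA mxE; apply: eq_bigr => k _; rewrite mxE.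
have -> : y *m X^T *m (Q *m diagv v *m Q^T) *m xq =
    (y *m (Q^T *m X)^T) *m diagv v *m (Q^T *m xq).
  by rewrite trmx_mul trmxK !mulmxA.
rewrite mul_row_diag_col mulr_sumr mulr_sumr -sumrB; apply: eq_bigr => k _.
rewrite [(y *m _) 0 k]mxE.
under [X in (X * v k)%R]eq_bigr do rewrite [(_^T) _ _]mxE mulrC.
set S := \sum_j _; set q := (Q^T *m xq) k 0.
rewrite mulrBr [q * b k 0]mulrC; congr (_ - _).
have -> : c^-1 * M%:R^-1 * (c * (S * v k * q)) = (c^-1 * c) * (M%:R^-1 * (S * v k * q)).
  by rewrite -!mulrA; congr (_ * _); rewrite mulrCA.
by rewrite mulVf// mul1r; ring.
Qed.

(** * Expected squared error for independent Gaussian data *)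

Section in_context_regression.
Context {R : realType} {dT : measure_display} {T : measurableType dT}.
Variables (P : probability T R) (d M : nat) (hM : (0 < M)%N).
Variables (Q : 'M[R]_d) (lam v b : 'I_d -> R) (sigma : R).
Hypothesis (lam0 : forall i, 0 <= lam i).
Hypothesis hQ : Q^T *m Q = 1%:M.
Variables (xs : 'I_M -> 'I_d -> T -> R) (xq : 'I_d -> T -> R) (eps : 'I_M -> T -> R).
Hypothesis hxs : forall j, gaussian_vector P (xs j) (Q *m diagv lam *m Q^T).
Hypothesis hxq : gaussian_vector P xq (Q *m diagv lam *m Q^T).
Hypothesis heps : forall j, has_law P (eps j) (gauss_law (sigma ^+ 2)).
Hypothesis hind : indep_blocks P (@comp_block d M) (comp_rv xs xq eps).

Let zq k t := \sum_i Q i k * xq i t.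
Let z j k t := \sum_i Q i k * xs j i t.
Let y j t := linear_form (z j) b t + eps j t.
Let G k t := v k / M%:R * (\sum_j z j k t * y j t) - b k.

Let gz j : gaussian_vector P (z j) (diagv lam).
Proof. exact: gaussian_vector_mul. Qed.
Let gzq : gaussian_vector P zq (diagv lam).
Proof. exact: gaussian_vector_mul. Qed.

Let fz j k : finite_moments P (z j k).
Proof. exact: (finite_moments_gaussian P d lam (z j) lam0 (gz j)). Qed.
Let fzq k : finite_moments P (zq k).
Proof. exact: (finite_moments_gaussian P d lam zq lam0 gzq). Qed.
Let fl j : finite_moments P (linear_form (z j) b).
Proof. exact: (finite_moments_linear_form P d lam (z j) lam0 (gz j)). Qed.
Let feps j : finite_moments P (eps j).
Proof. exact: finite_moments_gauss (sqr_ge0 sigma) (heps j). Qed.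
Let fy j : finite_moments P (y j).
Proof. exact: finite_momentsD. Qed.
Let fp j k : finite_moments P (fun t => z j k t * y j t).
Proof. exact: finite_momentsM (fz j k) (fy j). Qed.
Let fS k : finite_moments P (fun t => \sum_j z j k t * y j t).
Proof. by apply: finite_moments_sum => j; exact: fp. Qed.
Let fG k : finite_moments P (G k).
Proof.
apply: finite_momentsD; first exact: finite_momentsZ.
exact: finite_moments_cst.
Qed.

Let blockm := block_measurable (@comp_block d M) (comp_rv xs xq eps).

Let bm_z (J : pred (block_index M)) j k : J (inl (inl j)) -> blockm J (z j k).
Proof.
move=> Jj; apply: measurable_sum => i; apply: measurable_funM.
  exact: measurable_cst.
exact: (block_measurable_coord (@comp_block d M) (comp_rv xs xq eps) J (inl (inl (j, i)))).
Qed.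

Let bm_zq (J : pred (block_index M)) k : J (inl (inr tt)) -> blockm J (zq k).
Proof.
move=> Jj; apply: measurable_sum => i; apply: measurable_funM.
  exact: measurable_cst.
exact: (block_measurable_coord (@comp_block d M) (comp_rv xs xq eps) J (inl (inr i))).
Qed.

Let bm_eps (J : pred (block_index M)) j : J (inr j) -> blockm J (eps j).
Proof.
exact: (block_measurable_coord (@comp_block d M) (comp_rv xs xq eps) J (inr j)).
Qed.

Let bm_l (J : pred (block_index M)) j : J (inl (inl j)) ->
  blockm J (linear_form (z j) b).
Proof.
move=> Jj; apply: measurable_sum => k; apply: measurable_funM.
  exact: measurable_cst.
exact: bm_z.
Qed.

Let bm_p (J : pred (block_index M)) j k : J (inl (inl j)) -> J (inr j) ->
  blockm J (fun t => z j k t * y j t).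
Proof.
move=> Jj Je; apply: measurable_funM; first exact: bm_z.
by apply: measurable_funD; [exact: bm_l|exact: bm_eps].
Qed.

Let Eeps j : (\int[P]_t eps j t = 0)%R /\ (\int[P]_t (eps j t ^+ 2) = sigma ^+ 2)%R.
Proof. by have [] := gauss_law_moments P (eps j) _ (sqr_ge0 sigma) (heps j). Qed.

(** A general exponent covers both the cross term (n = 1, zero mean) and the pure noise term (n =
    2). *)
Let ind_eps j X (n : nat) : blockm (pred1 (inl (inl j))) X -> finite_moments P X ->
  (\int[P]_t (X t * eps j t ^+ n) = (\int[P]_t X t) * \int[P]_t (eps j t ^+ n))%R.
Proof.
move=> bX fX.
apply: (expectation_blocksM P _ _ (@comp_block d M) (comp_rv xs xq eps) hind
  (pred1 (inl (inl j))) (pred1 (inr j)) X (fun t => eps j t ^+ n)) => //.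
- by move=> x /=; apply/negP => /andP[/eqP -> /eqP].
- by apply: measurable_funX; apply: bm_eps; rewrite /= eqxx.
- elim: n => [|n IH]; first exact: finite_moments_cst.
  by under eq_fun do rewrite exprS; exact: finite_momentsM.
Qed.

Let Ep j k : (\int[P]_t (z j k t * y j t) = lam k * b k)%R.
Proof.
transitivity ((\int[P]_t (z j k t * linear_form (z j) b t) +
               \int[P]_t (z j k t * eps j t ^+ 1))%R).
  rewrite -finite_moments_RintegralD; last 2 first.
  - exact: finite_momentsM.
  - exact: (finite_momentsM P (z j k) (eps j)).
  by apply: eq_Rintegral => t _; rewrite /y mulrDr.
rewrite ind_eps//; last by apply: bm_z; rewrite /= eqxx.
rewrite [X in _ * X](_ : _ = 0) ?mulr0 ?addr0; last exact: (Eeps j).1.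
exact: (expectation_gaussian_linear_form P d lam (z j) lam0 (gz j)).
Qed.

(** The second moment of a label. *)
Let S0 := wdot lam b b + sigma ^+ 2.

Let Ep2 j k : (\int[P]_t ((z j k t * y j t) ^+ 2) =
  lam k * S0 + 2 * (lam k * b k) ^+ 2)%R.
Proof.
have fzl : finite_moments P (fun t => z j k t * linear_form (z j) b t).
  exact: finite_momentsM.
have fzzl : finite_moments P (fun t => z j k t * (z j k t * linear_form (z j) b t)).
  exact: finite_momentsM.
have fzz : finite_moments P (fun t => z j k t * z j k t) by exact: finite_momentsM.
have fe2 : finite_moments P (fun t => eps j t ^+ 2) by exact: (finite_momentsM P (eps j) (eps j)).
have fl2 : finite_moments P (fun t => (z j k t * linear_form (z j) b t) ^+ 2).
  exact: (finite_momentsM P _ _ fzl fzl).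
have fzzle : finite_moments P (fun t =>
    z j k t * (z j k t * linear_form (z j) b t) * eps j t ^+ 1).
  exact: (finite_momentsM P _ (eps j) fzzl (feps j)).
have fzze : finite_moments P (fun t => z j k t * z j k t * eps j t ^+ 2).
  exact: (finite_momentsM P _ _ fzz fe2).
(* The square is expanded with each power of the noise as last factor, the shape that [ind_eps]
   rewrites; the first term is left to Isserlis' formula. *)
transitivity ((\int[P]_t ((z j k t * linear_form (z j) b t) ^+ 2) +
   (2 * \int[P]_t ((z j k t * (z j k t * linear_form (z j) b t)) * eps j t ^+ 1) +
   \int[P]_t ((z j k t * z j k t) * eps j t ^+ 2)))%R).
  rewrite -finite_moments_RintegralZ -?finite_moments_RintegralD//;
    do ?[exact: fzze|exact: finite_momentsZ|apply: finite_momentsD].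
  by apply: eq_Rintegral => t _; rewrite /y; ring.
rewrite ind_eps//; last first.
  by apply: measurable_funM; [|apply: measurable_funM];
    [apply: bm_z|apply: bm_z|apply: bm_l]; rewrite /= eqxx.
rewrite [X in 2 * (_ * X)](_ : _ = 0) ?mulr0 ?add0r; last exact: (Eeps j).1.
rewrite ind_eps//; last by apply: measurable_funM; apply: bm_z; rewrite /= eqxx.
rewrite (Eeps j).2.
rewrite (expectation_gaussian_linear_form2 P d lam (z j) lam0 (gz j)).
rewrite (expectation_gaussianM P d lam (z j) lam0 (gz j)) eqxx /S0; ring.
Qed.

(** The two factors depend on the disjoint pairs of blocks of examples i and j. *)
Let Epp i j k : i != j ->
  (\int[P]_t ((z i k t * y i t) * (z j k t * y j t)) = (lam k * b k) ^+ 2)%R.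
Proof.
move=> ij.
rewrite (expectation_blocksM P _ _ (@comp_block d M) (comp_rv xs xq eps) hind
  (pred2 (inl (inl i)) (inr i)) (pred2 (inl (inl j)) (inr j))
  (fun t => z i k t * y i t) (fun t => z j k t * y j t)) ?Ep ?expr2//.
- move=> x /=; apply/negP => /andP[/orP[]/eqP -> /orP[]/eqP []] // E;
  by rewrite E eqxx in ij.
- by apply: bm_p; rewrite /= eqxx ?orbT.
- by apply: bm_p; rewrite /= eqxx ?orbT.
Qed.

(** One summand has variance [lam k * S0 + (lam k * b k) ^+ 2]. The sum over M examples multiplies
    it by M, and the squared factor v / M leaves v^2 / M. *)
Let EG2 k : (\int[P]_t (G k t ^+ 2) =
  M%:R^-1 * v k ^+ 2 * (lam k * S0 + (lam k * b k) ^+ 2)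
  + (v k * (lam k * b k) - b k) ^+ 2)%R.
Proof.
have ES : (\int[P]_t (\sum_j z j k t * y j t) = M%:R * (lam k * b k))%R.
  rewrite finite_moments_Rintegral_sum; last by move=> j; exact: fp.
  by under eq_bigr do rewrite Ep; rewrite sumr_const card_ord mulr_natl.
have ES2 := expectation_sumX2 P M (fun j t => z j k t * y j t) (lam k * b k) _
  (fun j => fp j k) (fun j => Ep2 j k) (fun i j => Epp i j k).
rewrite (expectation_affineX2 P _ _ _ _ _ (fS k) ES ES2).
by field; rewrite pnatr_eq0 -lt0n.
Qed.

Lemma expected_squared_error :
  (\int[P]_t ((\sum_k zq k t * G k t) ^+ 2) =
   \sum_k lam k * (M%:R^-1 * v k ^+ 2 * (lam k * S0 + (lam k * b k) ^+ 2)
    + (v k * (lam k * b k) - b k) ^+ 2))%R.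
Proof.
rewrite (expectation_bilinearX2 P d zq G lam)//.
- by apply: eq_bigr => k _; rewrite EG2.
- exact: (expectation_gaussianM P d lam zq lam0 gzq).
move=> k l.
(* The block of the query against all the other blocks. *)
apply: (expectation_blocksM P _ _ (@comp_block d M) (comp_rv xs xq eps) hind
  (pred1 (inl (inr tt))) (predC1 (inl (inr tt)))).
- by move=> i /=; case: eqP.
- by apply: measurable_funM; apply: bm_zq; rewrite /= eqxx.
- have bG k' : blockm (predC1 (inl (inr tt))) (G k').
    apply: measurable_funB; last exact: measurable_cst.
    apply: measurable_funM; first exact: measurable_cst.
    by apply: measurable_sum => j; exact: bm_p.
  exact: measurable_funM (bG k) (bG l).
- exact: finite_momentsM.
- exact: finite_momentsM.
Qed.

Lemma finite_moments_error : finite_moments P (fun t => \sum_k zq k t * G k t).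
Proof. by apply: finite_moments_sum => k; exact: finite_momentsM. Qed.

End in_context_regression.

(** * The error formula for the rank-r model *)

Theorem theorem4p3 (R : realType) (d N M r : nat)
  (hd : (0 < d)%N) (hN : (0 < N)%N) (hM : (0 < M)%N) (hr : (r <= d)%N)
  (sigma : R) (hsigma : 0 <= sigma)
  (Lambda Q : 'M[R]_d) (lam : 'I_d -> R)
  (hQ : Q^T *m Q = 1%:M)
  (hlam_dec : forall i j : 'I_d, (i <= j)%N -> lam j <= lam i)
  (hlam_ge0 : forall i : 'I_d, 0 <= lam i)
  (hLambda : Lambda = Q *m diagv lam *m Q^T)
  (c : R) (hc : c != 0)
  (w s xi : 'cV[R]_d)
  (hs : forall i : 'I_d, (r <= i)%N -> s i 0 = 0)
  (hxi : forall i : 'I_d, (i < r)%N -> xi i 0 = 0)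
  (hw : w = Q *m (s + xi))
  (dT : measure_display) (T : measurableType dT) (P : probability T R)
  (xs : 'I_M -> 'I_d -> T -> R) (xq : 'I_d -> T -> R) (eps : 'I_M -> T -> R)
  (hxs : forall j : 'I_M, gaussian_vector P (xs j) Lambda)
  (hxq : gaussian_vector P xq Lambda)
  (heps : forall j : 'I_M, has_law P (eps j) (gauss_law (sigma ^+ 2)))
  (hind : indep_blocks P (@comp_block d M) (comp_rv xs xq eps)) :
  let D := diagv lam in
  let V := diagv (vstar N r lam) in
  let U := c *: (Q *m V *m Q^T) in
  let u := c^-1 in
  let f := lsa (W_PV d u) (W_KQ U) in
  let X t : 'M[R]_(d, M) := \matrix_(i < d, j < M) xs j i t in
  let x_q t : 'cV[R]_d := \col_(i < d) xq i t in
  let y t : 'rV[R]_M :=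
    \row_(j < M) ((w^T *m col j (X t)) 0 0 + eps j t) in
  ('E_P[fun t => ((f (Ehat (X t) (x_q t) (y t)) - (w^T *m x_q t) 0 0) ^+ 2)%R] =
   ((M%:R)^-1 * qform (V *m V *m D *m D *m D) s
    + (M%:R)^-1 * (qform D (s + xi) + sigma ^+ 2) * \tr (V *m V *m D *m D)
    + qform D xi
    + \sum_(i < d | (i < r)%N)
        s i 0 ^+ 2 * lam i * (lam i * vstar N r lam i - 1) ^+ 2)%:E)%E.
Proof.
move=> D V U u f X x_q y; subst Lambda.
pose v := vstar N r lam; pose b k := (s + xi) k 0.
pose zq k t := \sum_i Q i k * xq i t.
pose z j k t := \sum_i Q i k * xs j i t.
pose G k t := v k / M%:R * (\sum_j z j k t * (linear_form (z j) b t + eps j t)) - b k.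
have zqE t k : (Q^T *m x_q t) k 0 = zq k t.
  by rewrite mxE; apply: eq_bigr => i _; rewrite !mxE.
have zE t j k : (Q^T *m X t) k j = z j k t.
  by rewrite mxE; apply: eq_bigr => i _; rewrite !mxE.
have yE t j : y t 0 j = linear_form (z j) b t + eps j t.
  rewrite mxE hw trmx_mul -mulmxA mxE; congr (_ + _); apply: eq_bigr => k _.
  rewrite [(s + xi)^T _ _]mxE; congr (_ * _).
  by rewrite mxE; apply: eq_bigr => i _; rewrite !mxE.
have errE t : f (Ehat (X t) (x_q t) (y t)) - (w^T *m x_q t) 0 0 =
    \sum_k zq k t * G k t.
  rewrite hw /f prediction_errorE//; apply: eq_bigr => k _.
  rewrite zqE; congr (_ * (_ * _ - _)); apply: eq_bigr => j _.
  by rewrite zE yE.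
have fm := finite_moments_error P d M Q lam v b sigma hlam_ge0 hQ
  xs xq eps hxs hxq heps.
have Eerr := expected_squared_error P d M hM Q lam v b sigma hlam_ge0 hQ
  xs xq eps hxs hxq heps hind.
rewrite unlock; under eq_integral do rewrite errE.
(* The expectation is an extended real; the finite second moment of the error allows passing to the
   real integral. *)
rewrite -[LHS]fineK; last by apply: integrable_fin_num => //; exact: (fm.2 2%N).
congr EFin; rewrite [LHS]Eerr.
have -> : wdot lam b b = qform D (s + xi).
  by rewrite /wdot qform_diagv; apply: eq_bigr => k _; rewrite expr2 mulrA.
set S := _ + sigma ^+ 2.
(* Every term becomes a sum over all indices, the last one extended by zeros, so the identity can be
   checked index by index. *)
rewrite /D /V !diagvM !qform_diagv mxtrace_diagv -/v [X in _ = _ + X]big_mkcond /=.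
rewrite !mulr_sumr -!big_split /=; apply: eq_bigr => k _.
(* Below r the component of [xi] is 0. From r on both the weight and the component of [s] are 0, and
   only [lam k] times the square of the component of [xi] survives. *)
rewrite /b mxE /v /vstar; case: (ltnP k r) => kr.
  by rewrite (hxi _ kr); ring.
by rewrite (hs _ kr); ring.
Qed.
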